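(* Let $T$ be a finite tree. Then the graph complement $\overline{T}$ is either contractible or homotopic to a $d$-sphere for some $d\ge 0$.
   Context: All graphs are finite and simple. The unit sphere $S(x)$ of a vertex $x$ is the subgraph induced by the neighbors of $x$. A graph is contractible if it is the one-point graph $K_1$ or (inductively) if it has a vertex $x$ such that both $S(x)$ and the graph $G-x$ with $x$ removed are contractible. A homotopy extension of $G$ adds a new vertex joined exactly to the vertices of a contractible induced subgraph $A$ of $G$; a homotopy reduction is the reverse (removing a vertex $x$ with $S(x)$ contractible). Two graphs are homotopic if one is obtained from the other by finitely many homotopy extensions and reductions. Spheres are defined inductively: the empty graph is the $(-1)$-sphere, and for $d\ge 0$ a $d$-sphere is a graph all of whose unit spheres are $(d-1)$-spheres and which becomes contractible after removing some vertex. A tree is a nonempty connected graph without closed loops (the one-point graph is included). *)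

(* Defs.v *)
From mathcomp Require Import all_boot all_order all_algebra.
Set Implicit Arguments.
Unset Strict Implicit.
Unset Printing Implicit Defensive.

Record sgraph := SGraph {
  vertex :> finType;
  edge : rel vertex;
  edge_sym : symmetric edge;
  edge_irr : irreflexive edge
}.

Definition isomorphic (G H : sgraph) : Prop :=
  exists2 f : G -> H, bijective f & {mono f : x y / edge x y}.

Section Constructions.
Variable G : sgraph.
Implicit Types (A : {set G}) (x y : G).

Definition induced_edge A (u v : {x : G | x \in A}) := edge (val u) (val v).

Fact induced_sym A : symmetric (@induced_edge A).
Proof. by move=> u v; apply: edge_sym. Qed.

Fact induced_irr A : irreflexive (@induced_edge A).
Proof. by move=> u; apply: edge_irr. Qed.

Definition induced A : sgraph := SGraph (@induced_sym A) (@induced_irr A).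

Definition unit_sphere x : sgraph := induced [set y | edge x y].

Definition remove x : sgraph := induced [set~ x].

(* The new vertex is [None]. *)
Definition extend_edge A (u v : option G) : bool :=
  match u, v with
  | Some x, Some y => edge x y
  | Some x, None => x \in A
  | None, Some y => y \in A
  | None, None => false
  end.

Fact extend_sym A : symmetric (extend_edge A).
Proof. by move=> [x|] [y|] //=; apply: edge_sym. Qed.

Fact extend_irr A : irreflexive (extend_edge A).
Proof. by move=> [x|] //=; apply: edge_irr. Qed.

Definition extend A : sgraph := SGraph (@extend_sym A) (@extend_irr A).

Definition compl_edge x y : bool := (x != y) && ~~ edge x y.

Fact compl_sym : symmetric compl_edge.
Proof. by move=> x y; rewrite /compl_edge eq_sym edge_sym. Qed.

Fact compl_irr : irreflexive compl_edge.
Proof. by move=> x; rewrite /compl_edge eqxx. Qed.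

Definition complement : sgraph := SGraph compl_sym compl_irr.

End Constructions.

Inductive contractible : sgraph -> Prop :=
| contractible_one (G : sgraph) : #|G| = 1 -> contractible G
| contractible_step (G : sgraph) (x : G) :
    contractible (unit_sphere x) -> contractible (remove x) -> contractible G.

Definition homotopy_extension (G H : sgraph) : Prop :=
  exists2 A : {set G}, contractible (induced A) & isomorphic H (extend A).

Definition homotopy_reduction (G H : sgraph) : Prop :=
  exists2 x : G, contractible (unit_sphere x) & isomorphic H (remove x).

(* Graphs are taken up to isomorphism, so zero steps relate isomorphic graphs. *)
Inductive homotopic (G : sgraph) : sgraph -> Prop :=
| homotopic_iso (H : sgraph) : isomorphic G H -> homotopic G H
| homotopic_ext (H K : sgraph) :
    homotopic G H -> homotopy_extension H K -> homotopic G K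
| homotopic_red (H K : sgraph) :
    homotopic G H -> homotopy_reduction H K -> homotopic G K.

Inductive is_sphere : int -> sgraph -> Prop :=
| sphere_empty (G : sgraph) : #|G| = 0 -> is_sphere (-1)%R G
| sphere_step (d : int) (G : sgraph) :
    (0 <= d)%R ->
    (forall x : G, is_sphere (d - 1)%R (unit_sphere x)) ->
    (exists x : G, contractible (remove x)) ->
    is_sphere d G.

(* [ucycle] also accepts [::] and, for an edge xy, [:: x; y]; closed loops are
   the simple cycles of length at least 3. *)
Definition is_tree (G : sgraph) : Prop :=
  [/\ 0 < #|G|,
      forall x y : G, connect (@edge G) x y
    & forall c : seq G, ucycle (@edge G) c -> size c < 3].

(* Main.v *)
Require Import Defs.
From mathcomp Require Import all_boot all_order all_algebra.

(** The cliques of the complement of a forest are the independent sets of the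
forest, and the theorem says that the independence complex of a forest is
contractible or a homotopy sphere.  The proof runs over all subforests, that is
over all subsets [A] of the vertex set of [T], by induction on the size of [A].
Acyclicity enters only through [acyclic_low_degree]: a nonempty [A] contains a
vertex [u] with at most one neighbour in [A].

- If [u] has no neighbour in [A], it is joined to everything in the complement,
  which is therefore a cone, and cones are contractible ([cone_contractible]).
- If the only neighbour of [u] is [v], and [v] has a further neighbour [w] in
  [A], then the unit sphere of [w] in the complement contains [u] but not [v],
  so it is a cone with apex [u].  Hence deleting [w] is a homotopy reduction
  that also reflects contractibility.
- If [u] and [v] are each other's only neighbour, they are two non-adjacent
  vertices of the complement which are joined to all others: the complement is
  the suspension of what remains.

The unit sphere of a pole of a suspension is the base, and deleting a pole
leaves a cone; so suspension preserves contractibility.  As it also commutes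
with unit spheres and removals of base vertices and with extensions, it
preserves the homotopy relation and turns spheres into spheres of one dimension
more.  The recursion ends at the empty graph, the
(-1)-sphere; a nonempty [A] never yields it, since the suspension step always
raises the dimension. *)

Set Implicit Arguments.
Unset Strict Implicit.
Unset Printing Implicit Defensive.

Import Order.TTheory GRing.Theory Num.Theory.

(** * Isomorphisms *)

Lemma isomorphic_refl G : isomorphic G G.
Proof. by exists id => //; exists id. Qed.

Lemma isomorphic_sym G H : isomorphic G H -> isomorphic H G.
Proof.
case=> f [g fK gK] fE; exists g; first by exists f.
by move=> x y; rewrite -fE !gK.
Qed.

Lemma isomorphic_trans G H K :
  isomorphic G H -> isomorphic H K -> isomorphic G K.
Proof.
case=> f f_bij fE [g g_bij gE]; exists (g \o f); first exact: bij_comp.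
by move=> x y /=; rewrite gE fE.
Qed.

Lemma isomorphic_card G H : isomorphic G H -> #|G| = #|H|.
Proof. by case=> f /bij_eq_card. Qed.

(** The source of nearly all isomorphisms below: unit spheres and vertex
removals are induced subgraphs, and they are recognised by exhibiting an
embedding with the right image. *)
Lemma embedding_isomorphic (G H : sgraph) (f : G -> H) (B : {set H}) :
    injective f -> {mono f : x y / edge x y} ->
    (forall x, f x \in B) -> (forall y, y \in B -> exists x, f x = y) ->
  isomorphic G (induced B).
Proof.
move=> f_inj fE fB f_surj; pose g x : induced B := exist _ (f x) (fB x).
exists g; last by move=> x y; apply: fE.
apply: inj_card_bij; first by move=> x y /(congr1 val) /f_inj.
rewrite /= card_sig -(card_codom f_inj); apply: subset_leq_card.
by apply/subsetP=> y; rewrite inE => /f_surj[x <-]; apply: codom_f.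
Qed.

Lemma isomorphic_induced_setT G : isomorphic G (induced [set: G]).
Proof.
apply: (@embedding_isomorphic _ _ id) => // y _.
by exists y.
Qed.

Lemma isomorphic_unit_sphere (G H : sgraph) (f : G -> H) (x : G) :
    bijective f -> {mono f : x y / edge x y} ->
  isomorphic (unit_sphere x) (unit_sphere (f x)).
Proof.
case=> g fK gK fE; apply: (@embedding_isomorphic (unit_sphere x) H (f \o val)).
- by move=> u v /(can_inj fK) /val_inj.
- by move=> u v; apply: fE.
- by case=> u /=; rewrite !inE fE.
- move=> y; rewrite inE -{1}[y]gK fE => xy.
  have xy' : g y \in [set z | edge x z] by rewrite inE.
  by exists (exist _ (g y) xy'); apply: gK.
Qed.

Lemma isomorphic_remove (G H : sgraph) (f : G -> H) (x : G) :
    bijective f -> {mono f : x y / edge x y} ->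
  isomorphic (remove x) (remove (f x)).
Proof.
case=> g fK gK fE; apply: (@embedding_isomorphic (remove x) H (f \o val)).
- by move=> u v /(can_inj fK) /val_inj.
- by move=> u v; apply: fE.
- by case=> u /=; rewrite !inE (inj_eq (can_inj fK)).
- move=> y; rewrite !inE -{1}[y]gK (inj_eq (can_inj fK)) => xy.
  have xy' : g y \in [set~ x] by rewrite !inE.
  by exists (exist _ (g y) xy'); apply: gK.
Qed.

Lemma isomorphic_contractible G H :
  isomorphic G H -> contractible G -> contractible H.
Proof.
move=> iGH cG; elim: cG H iGH => {G} [G G1|G x _ IHs _ IHr] H iGH.
  by apply: contractible_one; rewrite -(isomorphic_card iGH).
case: iGH => f f_bij fE; apply: (@contractible_step _ (f x)).
  exact/IHs/isomorphic_unit_sphere.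
exact/IHr/isomorphic_remove.
Qed.

Lemma isomorphic_is_sphere d G H :
  isomorphic G H -> is_sphere d G -> is_sphere d H.
Proof.
move=> iGH sG; elim: sG H iGH => {d G} [G G0|d G d0 _ IHs [x cx]] H iGH.
  by apply: sphere_empty; rewrite -(isomorphic_card iGH).
case: iGH => f f_bij fE; apply: sphere_step => // [y|].
  case: (f_bij) => g fK gK; rewrite -[y]gK.
  exact/IHs/isomorphic_unit_sphere.
by exists (f x); apply: isomorphic_contractible cx; apply: isomorphic_remove.
Qed.

(** * The homotopy relation *)

Lemma homotopic_isor G H K : homotopic G H -> isomorphic H K -> homotopic G K.
Proof.
case=> {}H => [iGH|H' hGH [A cA iH]|H' hGH [x cx iH]] iHK.
- exact/homotopic_iso/(isomorphic_trans iGH).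
- apply: homotopic_ext hGH _; exists A => //.
  exact: isomorphic_trans (isomorphic_sym iHK) iH.
- apply: homotopic_red hGH _; exists x => //.
  exact: isomorphic_trans (isomorphic_sym iHK) iH.
Qed.

Lemma homotopic_trans G H K : homotopic G H -> homotopic H K -> homotopic G K.
Proof.
move=> hGH; elim=> {K} [K|K L _ hGK|K L _ hGK]; first exact: homotopic_isor.
  exact: homotopic_ext hGK.
exact: homotopic_red hGK.
Qed.

(** Deleting a vertex from the base of a cone, or passing to the unit sphere of
such a vertex, leaves a smaller cone with the same apex. *)
Lemma cone_contractible (G : sgraph) (a : G) :
  (forall y, y != a -> edge a y) -> contractible G.
Proof.
have [n] := ubnP #|G|; elim: n => // n IHn in G a * => ltGn aG.
have [/eqP G1|G1] := boolP (#|G| == 1); first exact: contractible_one.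
have [x xa] : exists x, x != a.
  apply/existsP; apply: contraNT G1 => /existsPn Ga.
  apply/fintype1P; exists a => y; apply/eqP.
  by have := Ga y; rewrite negbK.
have smaller (A : {set G}) : x \notin A -> #|induced A| < n.
  move=> xA; rewrite card_sig; apply: (@leq_trans #|G|) => //.
  rewrite -cardsT; apply: proper_card; apply/properP; split=> //.
  by exists x.
have cone (A : {set G}) : x \notin A -> a \in A -> contractible (induced A).
  move=> xA aA; apply: (IHn (induced A) (exist _ a aA)); first exact: smaller.
  by move=> y ya; apply: aG; apply: contraNneq ya => ya; apply/eqP/val_inj.
apply: (@contractible_step _ x); apply: cone; rewrite !inE ?eqxx ?edge_irr //.
  by rewrite edge_sym aG.
by rewrite eq_sym.
Qed.

(** * Suspensions *)

Section Suspension.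
Variable G : sgraph.

Definition susp_edge (u v : bool + G) : bool :=
  match u, v with
  | inl _, inl _ => false
  | inr x, inr y => edge x y
  | _, _ => true
  end.

Fact susp_sym : symmetric susp_edge.
Proof. by move=> [b|x] [c|y] //=; apply: edge_sym. Qed.

Fact susp_irr : irreflexive susp_edge.
Proof. by move=> [b|x] //=; apply: edge_irr. Qed.

Definition susp : sgraph := SGraph susp_sym susp_irr.

End Suspension.

Definition susp_map (U V : Type) (f : U -> V) (u : bool + U) : bool + V :=
  match u with inl b => inl b | inr x => inr (f x) end.

Lemma susp_map_inj (U V : Type) (f : U -> V) :
  injective f -> injective (susp_map f).
Proof. by move=> f_inj [b|x] [c|y] //= [] => [->|/f_inj->]. Qed.

Lemma susp_map_mono (G H : sgraph) (f : G -> H) :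
  {mono f : x y / edge x y} ->
  {mono (susp_map f : susp G -> susp H) : x y / edge x y}.
Proof. by move=> fE [b|x] [c|y] //=; apply: fE. Qed.

Lemma isomorphic_susp G H : isomorphic G H -> isomorphic (susp G) (susp H).
Proof.
case=> f [g fK gK] fE; exists (susp_map f); last exact: susp_map_mono.
by exists (susp_map g) => [[b|x]|[b|x]] //=; rewrite ?fK ?gK.
Qed.

Lemma susp_induced (G : sgraph) (A : {set G}) (B : {set susp G}) :
    (forall b, inl b \in B) -> (forall x, (inr x \in B) = (x \in A)) ->
  isomorphic (susp (induced A)) (induced B).
Proof.
move=> BL BR; pose f := susp_map val : susp (induced A) -> susp G.
apply: (@embedding_isomorphic _ _ f).
- exact/susp_map_inj/val_inj.
- exact: (@susp_map_mono (induced A)).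
- by case=> [b|[x xA]] /=; rewrite ?BL ?BR.
- case=> [b _|x]; first by exists (inl b).
  by rewrite BR => xA; exists (inr (exist _ x xA)).
Qed.

Lemma susp_unit_sphere (G : sgraph) (x : G) :
  isomorphic (susp (unit_sphere x)) (unit_sphere (inr x : susp G)).
Proof. by apply: susp_induced => [b|y]; rewrite !inE. Qed.

Lemma susp_remove (G : sgraph) (x : G) :
  isomorphic (susp (remove x)) (remove (inr x : susp G)).
Proof. by apply: susp_induced => [b|y]; rewrite !inE. Qed.

Lemma unit_sphere_pole (G : sgraph) b :
  isomorphic G (unit_sphere (inl b : susp G)).
Proof.
apply: (@embedding_isomorphic _ (susp G) inr) => // [x y []|x|[c|x]] //.
- by rewrite inE.
- by rewrite inE.
- by exists x.
Qed.

(** What is left without one pole is a cone with the other pole as apex. *)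
Lemma remove_pole_contractible (G : sgraph) b :
  contractible (remove (inl b : susp G)).
Proof.
have bA : inl (~~ b) \in [set~ (inl b : susp G)].
  by rewrite !inE; case: b.
pose pole : remove (inl b : susp G) := exist _ (inl (~~ b)) bA.
apply: (@cone_contractible _ pole).
move=> [[c|x] cA] //=.
case/eqP; apply: val_inj; congr inl; move: cA; rewrite !inE; clear.
by case: b; case: c.
Qed.

(** Delete a pole: its unit sphere is [G] itself, and a cone remains. *)
Lemma susp_contractible G : contractible G -> contractible (susp G).
Proof.
move=> cG; apply: (@contractible_step (susp G) (inl true)).
  exact: isomorphic_contractible (unit_sphere_pole _ _) cG.
exact: remove_pole_contractible.
Qed.

Lemma is_sphere_ge d G : is_sphere d G -> (-1 <= d)%R.
Proof. by case=> // {}d _ d0 _ _; apply: le_trans d0. Qed.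

Lemma susp_is_sphere d G : is_sphere d G -> is_sphere (d + 1)%R (susp G).
Proof.
move=> sG; have d0 : (0 <= d + 1)%R by rewrite -lerBlDr sub0r (is_sphere_ge sG).
have pole b : is_sphere (d + 1 - 1)%R (unit_sphere (inl b : susp G)).
  by rewrite addrK; apply: isomorphic_is_sphere (unit_sphere_pole _ _) sG.
have contr : exists x : susp G, contractible (remove x).
  by exists (inl true); apply: remove_pole_contractible.
(* The unit sphere of a pole is the base; that of a base vertex is the
   suspension of its unit sphere in the base, whence the induction. *)
elim: sG d0 pole contr => {d G} [G G0|d G d0 sS IHs _] d1 pole contr.
  apply: sphere_step => // -[b|x]; first exact: pole.
  by have := max_card (pred1 x); rewrite card1 G0.
apply: sphere_step => // -[b|x]; first exact: pole.
apply: isomorphic_is_sphere (susp_unit_sphere x) _.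
rewrite addrAC; apply: IHs; first by rewrite subrK.
  move=> b; rewrite addrK.
  exact: isomorphic_is_sphere (unit_sphere_pole _ _) (sS x).
by exists (inl true); apply: remove_pole_contractible.
Qed.

(** The new vertex joins the base and is therefore adjacent to both poles, so
that it is attached along the suspension of [A]. *)
Lemma susp_extension G H :
  homotopy_extension G H -> homotopy_extension (susp G) (susp H).
Proof.
case=> A cA iH.
pose B : {set susp G} := [set u | if u is inr x then x \in A else true].
exists B.
  apply: isomorphic_contractible (susp_contractible cA).
  by apply: susp_induced => [b|x]; rewrite inE.
apply: isomorphic_trans (isomorphic_susp iH) _.
pose f (u : susp (extend A)) : extend B :=
  match u with
  | inl b => Some (inl b)
  | inr (Some x) => Some (inr x)
  | inr None => None
  end.
pose g (u : extend B) : susp (extend A) :=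
  match u with
  | Some (inl b) => inl b
  | Some (inr x) => inr (Some x)
  | None => inr None
  end.
exists f; first by exists g => [[b|[x|]]|[[b|x]|]].
by move=> [b|[x|]] [c|[y|]] //=; rewrite inE.
Qed.

Lemma susp_reduction G H :
  homotopy_reduction G H -> homotopy_reduction (susp G) (susp H).
Proof.
case=> x cx iH; exists (inr x).
  exact: isomorphic_contractible (susp_unit_sphere x) (susp_contractible cx).
exact: isomorphic_trans (isomorphic_susp iH) (susp_remove x).
Qed.

Lemma susp_homotopic G H : homotopic G H -> homotopic (susp G) (susp H).
Proof.
elim=> {H} [H iGH|H K _ hGH /susp_extension|H K _ hGH /susp_reduction].
- exact/homotopic_iso/isomorphic_susp.
- exact: homotopic_ext.
- exact: homotopic_red.
Qed.

(** * Vertices of low degree in acyclic graphs *)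

(** Otherwise simple paths inside [A] could be prolonged for ever: the first
vertex of a path has a neighbour other than the second vertex, and by
acyclicity that neighbour is not on the path. *)
Lemma acyclic_low_degree (G : sgraph) (A : {set G}) :
    (forall c : seq G, ucycle (@edge G) c -> size c < 3) -> A != set0 ->
  exists2 u, u \in A & {in A &, forall v w, edge u v -> edge u w -> v = w}.
Proof.
move=> acyc /set0Pn[a aA]; pose N u := [set v in A | edge u v].
have [/exists_inP[u uA /card_le1_eqP Nu]|/exists_inPn big] :=
    boolP [exists u in A, #|N u| <= 1].
  by exists u => // v w vA wA uv uw; apply: Nu; rewrite inE ?vA ?wA.
have next x z : x \in A -> exists y, [/\ y \in A, edge x y & y != z].
  move=> /big; rewrite -ltnNge (cardsD1 z) => gt1.
  have /card_gt0P[y] : 0 < #|N x :\ z| by case: (_ \in _) gt1 => // /ltnW.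
  by rewrite !inE => /and3P[yz yA xy]; exists y.
have long n : exists x p,
    [/\ size p = n, all [in A] (x :: p), path (@edge G) x p & uniq (x :: p)].
  elim: n => [|n [x [p [szp allp pathp uniqp]]]].
    by exists a, [::]; rewrite /= aA.
  have [y [yA xy yz]] := next x (head x p) (allP allp x (mem_head _ _)).
  exists y, (x :: p); split; first by rewrite /= szp.
  - by rewrite /= yA.
  - by rewrite /= edge_sym xy.
  rewrite cons_uniq uniqp andbT inE negb_or.
  rewrite (contraTneq _ xy) => [|->]; last by rewrite edge_irr.
  case: p => // z q in pathp uniqp yz {szp allp} *.
  rewrite inE negb_or yz /=; apply/negP => yq.
  case/path.splitP: yq pathp uniqp => q1 q2.
  rewrite -!cat_cons cat_uniq cat_path.
  move=> /andP[path1 _] /andP[uniq1 _].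
  (* The path up to y is closed by the edge from y back to x; since y is not z,
     the cycle has length at least three. *)
  have /acyc : ucycle (@edge G) (x :: z :: rcons q1 y).
    rewrite /ucycle uniq1 andbT /cycle rcons_path path1 /=.
    by rewrite last_rcons edge_sym.
  by rewrite /= size_rcons.
have [x [p [szp _ _ /card_uniqP cardp]]] := long #|G|.
by have := max_card [in x :: p]; rewrite cardp /= szp ltnn.
Qed.

(** * Complements of subforests *)

Definition contractible_or_sphere (G : sgraph) : Prop :=
  contractible G \/
  exists (d : int) (S : sgraph),
    (0 <= d)%R /\ is_sphere d S /\ homotopic G S.

Lemma contractible_or_sphere_iso G H :
  isomorphic G H -> contractible_or_sphere H -> contractible_or_sphere G.
Proof.
move=> iGH [cH|[d [S [d0 [sS hHS]]]]].
  by left; apply: isomorphic_contractible cH; apply: isomorphic_sym.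
right; exists d, S; do 2!split=> //.
by apply: homotopic_trans hHS; apply: homotopic_iso.
Qed.

(** A step [G] to [G - x] can be read in both ways: as a homotopy reduction if
[G - x] is a homotopy sphere, and as the start of a contraction of [G] if
[G - x] is contractible.  This is why the final alternative has honest
contractibility, not just homotopy to a point, on its left side. *)
Lemma contractible_or_sphere_remove (G : sgraph) (x : G) :
    contractible (unit_sphere x) -> contractible_or_sphere (remove x) ->
  contractible_or_sphere G.
Proof.
move=> cx [cr|[d [S [d0 [sS hS]]]]]; first by left; apply: contractible_step cr.
right; exists d, S; do 2!split=> //; apply: homotopic_trans hS.
apply: homotopic_red (homotopic_iso (isomorphic_refl G)) _.
by exists x => //; apply: isomorphic_refl.
Qed.

(** The empty base is the (-1)-sphere, whose suspension consists of two isolated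
points, a 0-sphere. *)
Lemma contractible_or_sphere_susp (G : sgraph) :
  #|G| = 0 \/ contractible_or_sphere G -> contractible_or_sphere (susp G).
Proof.
move=> [G0|[cG|[d [S [d0 [sS hS]]]]]]; last 2 first.
- by left; apply: susp_contractible.
- right; exists (d + 1)%R, (susp S); split; first exact: addr_ge0.
  by split; [apply: susp_is_sphere | apply: susp_homotopic].
right; exists 0%R, (susp G); split=> //; split.
  exact: (susp_is_sphere (sphere_empty G0)).
exact/homotopic_iso/isomorphic_refl.
Qed.

(** Connectedness is lost when vertices are deleted, so the induction is over
subsets of an acyclic graph. *)
Lemma induced_compl_contractible_or_sphere (T : sgraph)
    (acyc : forall c : seq T, ucycle (@edge T) c -> size c < 3)
    (A : {set complement T}) :
  A != set0 -> contractible_or_sphere (induced A).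
Proof.
have [n] := ubnP #|A|; elim: n A => // n IHn A ltAn A0.
have [u uA u1] := acyclic_low_degree acyc A0.
pose u' : induced A := exist _ u uA.
have [/exists_inP[v vA uv]|/exists_inPn isol] :=
    boolP [exists v in A, @edge T u v]; last first.
  (* An isolated vertex of the forest is the apex of a cone. *)
  left; apply: (@cone_contractible _ u') => -[y yA] yu.
  rewrite /= /induced_edge /= /compl_edge (isol y yA) andbT eq_sym.
  by apply: contraNneq yu => yu; apply/eqP/val_inj.
have vu : v != u by apply: contraTneq uv => ->; rewrite edge_irr.
have [/exists_inP[w wA /andP[vw wu]]|/exists_inPn onlyu] :=
    boolP [exists w in A, @edge T v w && (w != u)].
  have wv : w != v by apply: contraTneq vw => ->; rewrite edge_irr.
  have uw : ~~ @edge T u w by apply: contra wv => uw; apply/eqP/u1.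
  pose w' : induced A := exist _ w wA.
  (* The unit sphere of w avoids v, hence every neighbour of u: it is a cone
     with apex u. *)
  apply: (@contractible_or_sphere_remove _ w').
    have u'w : u' \in [set y | @edge (induced A) w' y].
      by rewrite inE /= /induced_edge /= /compl_edge wu edge_sym.
    apply: (@cone_contractible (unit_sphere w') (exist _ u' u'w)).
    move=> [[y yA] yw] yu.
    rewrite /= /induced_edge /= /induced_edge /= /compl_edge.
    move: (yw); rewrite inE /= /induced_edge /= /compl_edge => /andP[_ wy].
    apply/andP; split.
      by rewrite eq_sym; apply: contraNneq yu => yu; apply/eqP/val_inj/val_inj.
    by apply: contra wy => uy; rewrite (u1 y v yA vA uy uv) edge_sym.
  apply: (@contractible_or_sphere_iso _ (induced (A :\ w))).
    apply: (@embedding_isomorphic (remove w') (complement T) (val \o val)) => //.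
    - by move=> x y /val_inj /val_inj.
    - by case=> [[x xA] xw] /=; rewrite !inE xA andbT; move: xw; rewrite !inE.
    - move=> y /setD1P[yw yA].
      have yw' : exist _ y yA \in [set~ w'] by rewrite !inE.
      by exists (exist _ (exist _ y yA) yw').
  apply: IHn; first by rewrite (cardsD1 w) wA in ltAn.
  by apply/set0Pn; exists u; rewrite !inE eq_sym wu.
(* Now uv is a component of the forest on A, so u and v are the poles of a
   suspension over the remaining vertices. *)
pose B : {set complement T} := A :\ u :\ v.
have BP x : x \in B ->
    [/\ x != u, x != v, x \in A, ~~ @edge T u x & ~~ @edge T v x].
  rewrite !inE => /and3P[xv xu xA]; split=> //.
    by apply: contra xv => ux; apply/eqP/u1.
  by apply: contra (onlyu x xA) => ->.
apply: (@contractible_or_sphere_iso _ (susp (induced B))).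
  apply: isomorphic_sym.
  pose f (z : susp (induced B)) : complement T :=
    match z with inl b => if b then u else v | inr x => val x end.
  apply: (@embedding_isomorphic (susp (induced B)) (complement T) f).
  - move=> [b|[x xB]] [c|[y yB]] /=.
    + by case: b; case: c => // e; move: vu; rewrite e eqxx.
    + by case: (BP _ yB) => /eqP yu /eqP yv _ _ _; case: b => /esym.
    + by case: (BP _ xB) => /eqP xu /eqP xv _ _ _; case: c.
    + by move=> e; congr inr; apply: val_inj.
  - move=> [b|[x xB]] [c|[y yB]] //=; rewrite /compl_edge.
    + by case: b; case: c; rewrite ?eqxx // ?(@edge_sym T v u) uv andbF.
    + by case: (BP _ yB) => yu yv _ uy vy; case: b; rewrite eq_sym ?yu ?yv.
    + case: (BP _ xB) => xu xv _ ux vx.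
      by case: c; rewrite edge_sym ?xu ?xv.
  - by move=> [[]|[x xB]] //=; case: (BP _ xB).
  - move=> y yA; have [->|yu] := eqVneq y u; first by exists (inl true).
    have [->|yv] := eqVneq y v; first by exists (inl false).
    have yB : y \in B by rewrite !inE yu yv.
    by exists (inr (exist _ y yB)).
apply: contractible_or_sphere_susp.
have [B0|B0] := eqVneq B set0; first by left; rewrite card_sig B0 cards0.
right; apply: IHn B0; apply: leq_ltn_trans (subset_leq_card (subsetDl _ _)) _.
by rewrite (cardsD1 u) uA in ltAn.
Qed.

Theorem corollary3 (T : sgraph) (hT : is_tree T) :
  contractible (complement T) \/
  exists (d : int) (S : sgraph),
    (0 <= d)%R /\ is_sphere d S /\ homotopic (complement T) S.
Proof.
case: hT => T0 _ acyc.
apply: (contractible_or_sphere_iso (isomorphic_induced_setT (complement T))).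
apply: induced_compl_contractible_or_sphere acyc _ _.
by rewrite -card_gt0 cardsT.
Qed.
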